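(* There exists a non-adaptive algorithm with the following behaviour. It is given sample and query access to an unknown distribution $D$ over $\{0,1\}^n$ ($n \in \mathbb{N}$), and parameters $\zeta,\delta \in (0,1)$ and $r \in \mathbb{N}$ such that $\varepsilon := 17(\delta+\zeta) < 1$. It makes a number of queries that depends only on $\zeta,\delta$ and $r$ (and not on $n$), and it outputs either a full description of a distribution over $\{0,1\}^n$ or the symbol Fail, such that both of the following hold: (i) If $D$ is $(\zeta,\delta,r)$-clusterable, then with probability at least $2/3$ the algorithm outputs a full description of a distribution $D'$ over $\{0,1\}^n$ such that $d_{EM}(D, D'_{\sigma}) \leq \varepsilon$ for some permutation $\sigma:[n]\to[n]$. (ii) For every distribution $D$, the probability that the algorithm outputs a distribution $D'$ such that $d_{EM}(D,D'_\sigma) > \varepsilon$ for every permutation $\sigma:[n]\to[n]$ is at most $1/3$. (If $D$ is not $(\zeta,\delta,r)$-clusterable, the algorithm may output Fail with any probability.)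
   Context: Huge object model: an algorithm obtains independent samples $\mathbf{V}_1,\dots,\mathbf{V}_s \in \{0,1\}^n$ from an unknown distribution $D$ over $\{0,1\}^n$, and may query individual coordinates $v_{i,j}$ of sampled vectors; the query complexity is the total number of coordinates read. A non-adaptive algorithm fixes (using its random coins only) the sets of coordinates $J_1,\dots,J_s\subseteq[n]$ it will read from each sample before seeing any answer. For $\mathbf{X},\mathbf{Y}\in\{0,1\}^n$, $d_H(\mathbf{X},\mathbf{Y}) = |\{i: X_i\neq Y_i\}|/n$ is the normalized Hamming distance. The Earth Mover Distance $d_{EM}(D_1,D_2)$ between distributions over $\{0,1\}^n$ is the minimum of $\sum_{\mathbf{X},\mathbf{Y}} f_{\mathbf{X}\mathbf{Y}} d_H(\mathbf{X},\mathbf{Y})$ over all $f_{\mathbf{X}\mathbf{Y}}\in[0,1]$ with $\sum_{\mathbf{Y}} f_{\mathbf{X}\mathbf{Y}} = D_1(\mathbf{X})$ for all $\mathbf{X}$ and $\sum_{\mathbf{X}} f_{\mathbf{X}\mathbf{Y}} = D_2(\mathbf{Y})$ for all $\mathbf{Y}$. For a permutation $\sigma:[n]\to[n]$, $D_\sigma$ is the distribution with $D(w_1,\dots,w_n) = D_\sigma(w_{\sigma(1)},\dots,w_{\sigma(n)})$ for all $(w_1,\dots,w_n)\in\{0,1\}^n$. A distribution $D$ over $\{0,1\}^n$ is $(\zeta,\delta,r)$-clusterable if there is a partition $\mathcal{C}_0,\mathcal{C}_1,\dots,\mathcal{C}_s$ of $\{0,1\}^n$ with $s\le r$, $D(\mathcal{C}_0)\le\zeta$,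 and $d_H(\mathbf{U},\mathbf{V})\le\delta$ for all $\mathbf{U},\mathbf{V}\in\mathcal{C}_i$, for every $1\le i\le s$. *)

(* Defs.v *)
From HB Require Import structures.
From mathcomp Require Import all_boot all_order all_algebra all_fingroup.
From mathcomp Require Import all_classical all_reals.

Set Implicit Arguments.
Unset Strict Implicit.
Unset Printing Implicit Defensive.

Import Order.TTheory GRing.Theory Num.Theory.
Local Open Scope ring_scope.

Record fdist (R : realType) (T : finType) := FDist {
  pmf :> T -> R;
  pmf_ge0 : forall x, 0 <= pmf x;
  pmf_sum1 : \sum_x pmf x = 1 }.

Definition prob (R : realType) (T : finType) (P : fdist R T) (E : T -> Prop) : R :=
  \sum_(x | `[< E x >]) P x.

Section Product.
Context {R : realType} {S T : finType} (P : fdist R S) (Q : fdist R T).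

Let f (x : S * T) : R := P x.1 * Q x.2.

Let f_ge0 x : 0 <= f x.
Proof. by rewrite mulr_ge0 ?pmf_ge0. Qed.

Let f_sum1 : \sum_x f x = 1.
Proof.
rewrite -(pair_bigA _ (fun x y => P x * Q y)) /= -[RHS](pmf_sum1 P).
by apply: eq_bigr => x _; rewrite -mulr_sumr pmf_sum1 mulr1.
Qed.

Definition fdist_prod : fdist R (S * T)%type := FDist f_ge0 f_sum1.
End Product.

Section IID.
Context {R : realType} {T : finType} (P : fdist R T) (s : nat).

Let f (x : {ffun 'I_s -> T}) : R := \prod_i P (x i).

Let f_ge0 x : 0 <= f x.
Proof. by apply: prodr_ge0 => i _; exact: pmf_ge0. Qed.

Let f_sum1 : \sum_x f x = 1.
Proof.
by rewrite /f -(bigA_distr_bigA (fun _ : 'I_s => pmf P)) big1 // => i _; exact: pmf_sum1.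
Qed.

Definition fdist_iid : fdist R {ffun 'I_s -> T} := FDist f_ge0 f_sum1.
End IID.

Definition cube (n : nat) : finType := {ffun 'I_n -> bool}.

(* For n = 0 this is 0 / 0 = 0, which is harmless as cube 0 has one point. *)
Definition dH (R : realType) (n : nat) (x y : cube n) : R :=
  #|[pred i | x i != y i]|%:R / n%:R.

Definition transport_plan (R : realType) (n : nat) (D1 D2 : fdist R (cube n))
    (f : cube n -> cube n -> R) : Prop :=
  [/\ forall x y, 0 <= f x y <= 1,
      forall x, \sum_y f x y = D1 x
    & forall y, \sum_x f x y = D2 y].

(* The set of transport plans is nonempty (it contains D1 x * D2 y) and
   compact, so this infimum is a minimum. *)
Definition dEM (R : realType) (n : nat) (D1 D2 : fdist R (cube n)) : R :=
  inf [set c : R | exists2 f, transport_plan D1 D2 f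
                   & c = \sum_x \sum_y f x y * dH R x y]%classic.

Definition perm_word (n : nat) (s : {perm 'I_n}) (w : cube n) : cube n :=
  [ffun i => w (s i)].

Lemma perm_wordK (n : nat) (s : {perm 'I_n}) :
  cancel (perm_word s) (perm_word s^-1%g).
Proof. by move=> w; apply/ffunP => i; rewrite !ffunE permKV. Qed.

Section Perm.
Context {R : realType} {n : nat} (D : fdist R (cube n)) (s : {perm 'I_n}).

Let f (w : cube n) : R := D (perm_word s^-1%g w).

Let f_ge0 w : 0 <= f w.
Proof. exact: pmf_ge0. Qed.

Let f_sum1 : \sum_w f w = 1.
Proof.
rewrite -[RHS](pmf_sum1 D) [RHS](reindex_inj (h := perm_word s^-1%g)) //.
exact: can_inj (perm_wordK _).
Qed.

Definition fdist_perm : fdist R (cube n) := FDist f_ge0 f_sum1.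

Lemma fdist_permE (w : cube n) : D w = fdist_perm (perm_word s w).
Proof. by rewrite /= /f perm_wordK. Qed.
End Perm.

(* Blocks may be empty; block ord0 is the exceptional one. *)
Definition clusterable (R : realType) (n : nat) (zeta delta : R) (r : nat)
    (D : fdist R (cube n)) : Prop :=
  exists s : nat, (s <= r)%N /\
  exists C : 'I_s.+1 -> {set cube n},
    [/\ forall w, exists! i, w \in C i,
        \sum_(w in C ord0) D w <= zeta
      & forall i, i != ord0 ->
          forall u v, u \in C i -> v \in C i -> dH R u v <= delta].

(* What is seen of s samples when only the coordinates in J i are read from
   sample i; None marks an unread coordinate. *)
Definition answers (s n : nat) : Type := 'I_s -> 'I_n -> option bool.

Definition read (s n : nat) (J : 'I_s -> {set 'I_n}) (V : 'I_s -> cube n) :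
    answers s n :=
  fun i j => if j \in J i then Some (V i j) else None.

(* The query sets depend on the coins only, never on the answers. The output
   None stands for Fail. *)
Record nonadaptive_alg (R : realType) (n : nat) := NonadaptiveAlg {
  coins : finType;
  coin_dist : fdist R coins;
  nsamples : nat;
  query_sets : coins -> 'I_nsamples -> {set 'I_n};
  decide : coins -> answers nsamples n -> option (fdist R (cube n)) }.

Definition nqueries (R : realType) (n : nat) (A : nonadaptive_alg R n)
    (c : coins A) : nat :=
  \sum_(i < nsamples A) #|query_sets c i|.

Definition run (R : realType) (n : nat) (A : nonadaptive_alg R n) (c : coins A)
    (V : 'I_(nsamples A) -> cube n) : option (fdist R (cube n)) :=
  decide c (read (query_sets c) V).

Definition prob_run (R : realType) (n : nat) (A : nonadaptive_alg R n)
    (D : fdist R (cube n)) (E : option (fdist R (cube n)) -> Prop) : R :=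
  prob (fdist_prod (coin_dist A) (fdist_iid D (nsamples A)))
       (fun x => E (run x.1 x.2)).

(* Main.v *)
Require Import Defs.
From mathcomp Require Import all_boot all_order all_algebra all_fingroup.
From mathcomp Require Import all_classical all_reals.
From mathcomp Require Import lra ring.

(** The algorithm reads the same [t] uniformly random coordinates from [s]
    training and [m] test samples. View all [s + m] samples as a matrix: up to a
    permutation of the coordinates it is determined by how often each column
    occurs. These frequencies are estimated by the observed columns, so any
    matrix [U] compatible with the observation agrees, after some permutation,
    with the true samples up to distance [delta] in every row. The algorithm
    fails if more than a fraction [10 zeta] of the test rows of [U] are far from
    all its training rows, and otherwise outputs the empirical distribution of
    the test rows.

    Closeness: cut the cube into cells of radius [5 delta] around the training
    samples, plus the far points. The test samples estimate the mass of every
    cell, so [D] can be coupled with the test rows such that mismatched cells and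
    far points have small mass.

    Completeness: if [D] is clusterable, a cluster of mass [p] contains a new
    point but no training point with probability [p (1 - p)^s <= 1 / (s + 1)],
    hence the expected far mass is at most [zeta + r / (s + 1)], and Markov's
    inequality bounds the probability of failure. *)

Set Implicit Arguments.
Unset Strict Implicit.
Unset Printing Implicit Defensive.

Import Order.TTheory GRing.Theory Num.Theory.
Local Open Scope ring_scope.

(** * Probability on finite types *)

Section Probability.
Context {R : realType}.
Implicit Types T : finType.

Definition expect T (P : fdist R T) (g : T -> R) : R := \sum_x P x * g x.

Lemma prob_expect T (P : fdist R T) (E : T -> Prop) :
  prob P E = expect P (fun x => `[< E x >]%:R).
Proof.
rewrite /prob /expect big_mkcond; apply: eq_bigr => x _.
by case: ifP; rewrite (mulr1, mulr0).
Qed.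

Lemma le_expect T (P : fdist R T) (g h : T -> R) :
  (forall x, g x <= h x) -> expect P g <= expect P h.
Proof. by move=> gh; apply: ler_sum => x _; rewrite ler_wpM2l ?pmf_ge0. Qed.

Lemma expect_cst T (P : fdist R T) (c : R) : expect P (fun=> c) = c.
Proof. by rewrite /expect -mulr_suml pmf_sum1 mul1r. Qed.

Lemma expectZ T (P : fdist R T) (c : R) (g : T -> R) :
  expect P (fun x => c * g x) = c * expect P g.
Proof. by rewrite /expect mulr_sumr; apply: eq_bigr => x _; rewrite mulrCA. Qed.

Lemma expect_sum T (I : finType) (P : fdist R T) (g : I -> T -> R) :
  expect P (fun x => \sum_i g i x) = \sum_i expect P (g i).
Proof.
by rewrite /expect exchange_big; apply: eq_bigr => x _; rewrite mulr_sumr.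
Qed.

Lemma prob_mono T (P : fdist R T) (E F : T -> Prop) :
  (forall x, E x -> F x) -> prob P E <= prob P F.
Proof.
move=> EF; rewrite !prob_expect; apply: le_expect => x; rewrite ler_nat.
by case: (asboolP (E x)) => // /EF ?; rewrite asboolT.
Qed.

Lemma prob_or T (P : fdist R T) (E F : T -> Prop) :
  prob P (fun x => E x \/ F x) <= prob P E + prob P F.
Proof.
rewrite !prob_expect /expect -big_split; apply: ler_sum => x _ /=.
rewrite -mulrDr ler_wpM2l ?pmf_ge0// -natrD ler_nat.
by do 3![case: asboolP => //]; tauto.
Qed.

Lemma prob_compl T (P : fdist R T) (E : T -> Prop) :
  prob P E = 1 - prob P (fun x => ~ E x).
Proof.
apply/eqP; rewrite -subr_eq opprK !prob_expect /expect -big_split /=.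
rewrite -[eqbRHS](pmf_sum1 P); apply/eqP/eq_bigr => x _.
by rewrite -mulrDr -natrD; do 2!case: asboolP => //; rewrite ?mulr1 //.
Qed.

Lemma prob_sure T (P : fdist R T) (E : T -> Prop) : (forall x, E x) -> prob P E = 1.
Proof.
move=> Ex; rewrite prob_expect -[RHS](expect_cst P).
by apply: eq_bigr => x _; rewrite asboolT.
Qed.

Lemma markov T (P : fdist R T) (g : T -> R) (a : R) :
  0 < a -> (forall x, 0 <= g x) -> prob P (fun x => a < g x) <= expect P g / a.
Proof.
move=> a0 g0; rewrite prob_expect mulrC -expectZ; apply: le_expect => x.
case: asboolP => [/ltW|_]; first by rewrite ler_pdivlMl // mulr1.
by rewrite mulr_ge0 ?invr_ge0 // ltW.
Qed.

Lemma prob_fdist_prod S T (P : fdist R S) (Q : fdist R T) (E : S * T -> Prop) :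
  prob (fdist_prod P Q) E = expect Q (fun y => prob P (fun x => E (x, y))).
Proof.
rewrite prob_expect /expect /=.
transitivity (\sum_x \sum_y P x * Q y * `[< E (x, y) >]%:R).
  by rewrite pair_bigA; apply: eq_bigr => -[x y] _.
rewrite exchange_big /=; apply: eq_bigr => y _; rewrite prob_expect /expect mulr_sumr.
by apply: eq_bigr => x _; rewrite mulrAC mulrC.
Qed.

Lemma expect_iid_prod T (P : fdist R T) m (h : 'I_m -> T -> R) :
  expect (fdist_iid P m) (fun x => \prod_i h i (x i)) =
  \prod_i expect P (h i).
Proof.
rewrite /expect bigA_distr_bigA; apply: eq_bigr => x _ /=.
by rewrite -big_split.
Qed.

Lemma expect_iid_coord T (P : fdist R T) m (g : T -> R) (i : 'I_m) :
  expect (fdist_iid P m) (fun x => g (x i)) = expect P g.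
Proof.
transitivity (expect (fdist_iid P m)
    (fun x => \prod_j (if j == i then g else fun=> 1) (x j))).
  apply: eq_bigr => x _; congr (_ * _); rewrite (bigD1 i) //= eqxx big1 ?mulr1 // => j.
  by move=> /negPf ->.
rewrite (expect_iid_prod P (fun j => if j == i then g else fun=> 1)).
rewrite (bigD1 i) //= eqxx big1 ?mulr1 // => j /negPf ->.
exact: expect_cst.
Qed.

(** Expanding the square, the cross terms factor by independence and vanish because [g] is
    centred. *)
Lemma expect_iid_sum_sqr T (P : fdist R T) m (g : T -> R) :
  expect P g = 0 ->
  expect (fdist_iid P m) (fun x => (\sum_i g (x i)) ^+ 2) =
  m%:R * expect P (fun y => g y ^+ 2).
Proof.
move=> g0.
transitivity (\sum_i \sum_j expect (fdist_iid P m) (fun x => g (x i) * g (x j))).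
  under [RHS]eq_bigr => i _ do
    rewrite -(expect_sum _ (fun j (x : {ffun 'I_m -> T}) => g (x i) * g (x j))).
  rewrite -expect_sum; apply: eq_bigr => x _; congr (_ * _).
  by rewrite expr2 mulr_suml; apply: eq_bigr => i _; rewrite mulr_sumr.
rewrite -[m in m%:R]card_ord -sum1_card natr_sum mulr_suml.
apply: eq_bigr => i _; rewrite mul1r (bigD1 i) //= big1 ?addr0.
  by rewrite -(expect_iid_coord P _ i); apply: eq_bigr => x _; rewrite expr2.
move=> j ji.
transitivity (expect (fdist_iid P m)
    (fun x => \prod_k (if (k == i) || (k == j) then g else fun=> 1) (x k))).
  apply: eq_bigr => x _; congr (_ * _); rewrite (bigD1 i) //= eqxx (bigD1 j) //= eqxx orbT.
  rewrite big1 ?mulr1 // => k /andP[/negPf -> /negPf ->] //.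
rewrite (expect_iid_prod P (fun k => if (k == i) || (k == j) then g else fun=> 1)).
by rewrite (bigD1 i) //= eqxx /= g0 mul0r.
Qed.

Definition ffun_cat T s m (y : {ffun 'I_s -> T}) (z : {ffun 'I_m -> T}) :
    {ffun 'I_(s + m) -> T} :=
  [ffun k : 'I_(s + m) => match fintype.split k with inl i => y i | inr j => z j end].

Lemma ffun_catl T s m (y : {ffun 'I_s -> T}) (z : {ffun 'I_m -> T}) i :
  ffun_cat y z (lshift m i) = y i.
Proof. by rewrite ffunE; case: split_ordP => j => [/lshift_inj -> //|/eqP]; rewrite eq_lrshift. Qed.

Lemma ffun_catr T s m (y : {ffun 'I_s -> T}) (z : {ffun 'I_m -> T}) j :
  ffun_cat y z (rshift s j) = z j.
Proof. by rewrite ffunE; case: split_ordP => k => [/eqP|/rshift_inj -> //]; rewrite eq_rlshift. Qed.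

(** Fubini; it lets the training samples be fixed before averaging over the test samples. *)
Lemma expect_iid_cat T (P : fdist R T) s m (g : {ffun 'I_(s + m) -> T} -> R) :
  expect (fdist_iid P (s + m)) g =
  expect (fdist_iid P s) (fun y => expect (fdist_iid P m) (fun z => g (ffun_cat y z))).
Proof.
rewrite /expect; under [RHS]eq_bigr => y _ do rewrite mulr_sumr.
rewrite pair_bigA /= (reindex (fun u : {ffun 'I_s -> T} * {ffun 'I_m -> T} => ffun_cat u.1 u.2)) /=.
  apply: eq_bigr => -[y z] _ /=; rewrite mulrA big_split_ord /=; congr (_ * _ * _).
    by apply: eq_bigr => i _; rewrite ffun_catl.
  by apply: eq_bigr => i _; rewrite ffun_catr.
exists (fun x => ([ffun i => x (lshift m i)], [ffun j => x (rshift s j)])).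
  by move=> [y z] _ /=; congr pair; apply/ffunP => i; rewrite ffunE ?ffun_catl ?ffun_catr.
move=> x _ /=; apply/ffunP => k; case: (split_ordP k) => i ->.
  by rewrite ffun_catl ffunE.
by rewrite ffun_catr ffunE.
Qed.

Section Map.
Context {T K : finType} (P : fdist R T) (f : T -> K).

Let h (a : K) : R := \sum_(x | f x == a) P x.

Let h_ge0 a : 0 <= h a.
Proof. by apply: sumr_ge0 => x _; exact: pmf_ge0. Qed.

Let h_sum1 : \sum_a h a = 1.
Proof. by rewrite -[RHS](pmf_sum1 P) [RHS](partition_big f xpredT). Qed.

Definition fdist_map : fdist R K := FDist h_ge0 h_sum1.
End Map.

Section Uniform.
Variable n : nat.

Let u (i : 'I_n.+1) : R := n.+1%:R^-1.

Let u_ge0 i : 0 <= u i.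
Proof. by rewrite invr_ge0. Qed.

Let u_sum1 : \sum_i u i = 1.
Proof. by rewrite sumr_const card_ord -[LHS]mulr_natr mulVf ?pnatr_eq0. Qed.

Definition fdist_uniform : fdist R 'I_n.+1 := FDist u_ge0 u_sum1.
End Uniform.

(** Twice the total variation distance. *)
Definition l1 (K : finType) (p q : fdist R K) : R := \sum_a `|p a - q a|.

(** Cauchy-Schwarz against the constant function, from
    [d a * d b <= d a ^+ 2 / 2 + d b ^+ 2 / 2]. *)
Lemma sqr_sum_le (K : finType) (d : K -> R) :
  (\sum_a d a) ^+ 2 <= #|K|%:R * \sum_a d a ^+ 2.
Proof.
have -> : #|K|%:R * \sum_a d a ^+ 2 =
    \sum_(a : K) \sum_(b : K) (d a ^+ 2 / 2 + d b ^+ 2 / 2).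
  under [RHS]eq_bigr => a _ do rewrite big_split sumr_const /= -[_ *+ #|_|]mulr_natl.
  rewrite [RHS]big_split /= sumr_const -mulr_sumr -[X in _ = _ + X]mulr_natl -mulrDr.
  by congr (_ * _); rewrite -mulr_suml -splitr.
rewrite expr2 mulr_suml; apply: ler_sum => a _; rewrite mulr_sumr.
apply: ler_sum => b _; rewrite -subr_ge0.
have -> : d a ^+ 2 / 2 + d b ^+ 2 / 2 - d a * d b = (d a - d b) ^+ 2 / 2 by field.
by rewrite divr_ge0 ?sqr_ge0.
Qed.

(** Second moment method: each empirical frequency has variance at most [Q a / m.+1], and
    [sqr_sum_le] costs a factor [#|K|]. The bound does not involve [#|T|], which keeps the number of
    queries independent of [n]. *)
Lemma empirical_l1 (T K : finType) (P : fdist R T) (f : T -> K) m (eta : R) :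
  0 < eta ->
  prob (fdist_iid P m.+1)
    (fun x => eta < l1 (fdist_map (fdist_uniform m) (f \o x)) (fdist_map P f))
  <= #|K|%:R / (m.+1%:R * eta ^+ 2).
Proof.
move=> eta0; set Q := fdist_map P f.
pose g a y : R := (f y == a)%:R - Q a.
have Eind a : expect P (fun y => (f y == a)%:R) = Q a.
  rewrite /expect /= [RHS]big_mkcond; apply: eq_bigr => y _.
  by case: eqP; rewrite (mulr1, mulr0).
have g0 a : expect P (g a) = 0.
  have := Eind a; rewrite /expect /g.
  under [X in _ -> X = _]eq_bigr => y _ do rewrite mulrBr.
  by rewrite sumrB => ->; rewrite -mulr_suml pmf_sum1 mul1r subrr.
(* An indicator is idempotent, so [g a y ^+ 2] is affine in it and the variance is
   [Q a - Q a ^+ 2]. *)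
have g2 a : expect P (fun y => g a y ^+ 2) <= Q a.
  have -> : expect P (fun y => g a y ^+ 2) =
      expect P (fun y => (f y == a)%:R - Q a * (f y == a)%:R) - Q a * expect P (g a).
    rewrite -expectZ /expect -sumrB; apply: eq_bigr => y _; rewrite /g.
    case: (f y == a); last by rewrite /=; ring.
    by rewrite /=; ring.
  rewrite g0 mulr0 subr0 -[leRHS]Eind; apply: le_expect => y.
  by rewrite gerBl mulr_ge0 //; exact: pmf_ge0.
have empE a (x : {ffun 'I_m.+1 -> T}) :
    fdist_map (fdist_uniform m) (f \o x) a - Q a = m.+1%:R^-1 * \sum_i g a (x i).
  rewrite /g sumrB sumr_const card_ord mulrBr -[Q a *+ _]mulr_natl mulKf ?pnatr_eq0 //.
  congr (_ - _); rewrite /= big_mkcond mulr_sumr; apply: eq_bigr => i _ /=.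
  by case: eqP; rewrite (mulr1, mulr0).
have E2 : expect (fdist_iid P m.+1) (fun x => l1 (fdist_map (fdist_uniform m) (f \o x)) Q ^+ 2)
    <= #|K|%:R / m.+1%:R.
  apply: (@le_trans _ _ (expect (fdist_iid P m.+1) (fun x =>
    \sum_a #|K|%:R * (m.+1%:R^-1 ^+ 2 * (\sum_i g a (x i)) ^+ 2)))).
    apply: le_expect => x; apply: le_trans (sqr_sum_le _) _.
    rewrite -mulr_sumr ler_wpM2l //; apply: ler_sum => a _.
    by rewrite empE real_normK ?num_real // exprMn.
  rewrite expect_sum.
  apply: (@le_trans _ _ (\sum_a #|K|%:R / m.+1%:R * Q a)).
    apply: ler_sum => a _; rewrite !expectZ expect_iid_sum_sqr //.
    rewrite -[leRHS]mulrA ler_wpM2l // [_ * (m.+1%:R * _)]mulrA expr2 -mulrA mulrCA mulrA.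
    rewrite [X in X * _](_ : _ = m.+1%:R^-1); last by rewrite mulVKf ?pnatr_eq0.
    by rewrite ler_wpM2l ?invr_ge0.
  by rewrite -mulr_sumr pmf_sum1 mulr1.
apply: (@le_trans _ _ (prob (fdist_iid P m.+1) (fun x =>
  eta ^+ 2 < l1 (fdist_map (fdist_uniform m) (f \o x)) Q ^+ 2))).
  apply: prob_mono => x lt; rewrite ltr_pXn2r ?nnegrE //; first exact: ltW.
  by apply: sumr_ge0.
apply: le_trans (markov _ _ _) _; first by rewrite exprn_gt0.
  by move=> x; exact: sqr_ge0.
by rewrite [(m.+1%:R * _)^-1]invfM [leRHS]mulrA ler_wpM2r // invr_ge0 sqr_ge0.
Qed.
End Probability.

(** * Matchings and couplings *)

Section Matching.
Variables (n : nat) (K : finType).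
Implicit Types (f g : 'I_n -> K) (s : {perm 'I_n}).

(* Take a permutation with fewest mismatches. If [f i = a] is mismatched, no
   [j] with [g (s j) = a] is mismatched, since swapping the images of [i] and
   [j] would then remove a mismatch. *)
Lemma exists_matching_perm f g :
  exists s, (#|[pred i | f i != g (s i)]| <=
             \sum_a (#|[pred i | f i == a]| - #|[pred i | g i == a]|))%N.
Proof.
pose bad s := [pred i | f i != g (s i)].
case: (@arg_minnP _ (1%g : {perm 'I_n}) xpredT (fun s => #|bad s|)) => // s _ smin.
exists s; rewrite -sum1_card (partition_big f xpredT) //=.
apply: leq_sum => a _; rewrite sum1_card.
have [/existsP[i /andP[bi /eqP fi]]|/existsPn nobad] :=
    boolP [exists i, (i \in bad s) && (f i == a)]; last first.
  by rewrite eq_card0 // => i; apply/negbTE/nobad.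
have good j : g (s j) = a -> f j = a.
  move=> gj; apply/eqP; apply: contraT => fj.
  have ij : i != j by apply: contraNneq fj => <-; rewrite fi.
  suff : (#|bad (tperm i j * s)%g| < #|bad s|)%N by rewrite ltnNge smin.
  apply: proper_card; apply/properP; split.
    apply/fintype.subsetP => k; rewrite !inE permM.
    case: tpermP => [->|->|//]; first by rewrite fi gj eqxx.
    by rewrite gj.
  by exists i; rewrite // !inE permM tpermL fi gj eqxx.
(* In a fibre with a mismatch, every position with [g (s k) = a] is matched, so the mismatches
   number exactly the difference of the two counts. *)
have -> : #|[pred k | g k == a]| = #|[pred k | g (s k) == a]|.
  rewrite -(fintype.card_image (@perm_inj _ s) [pred k | g (s k) == a]).
  apply: eq_card => k; rewrite -[k in RHS](permKV s) (fintype.mem_image (@perm_inj _ s)).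
  by rewrite !inE permKV.
rewrite -(cardID [pred k | g (s k) == a] [pred k | f k == a]).
rewrite [X in (_ <= X + _ - _)%N](_ : _ = #|[pred k | g (s k) == a]|).
  rewrite addKn; apply/eq_leq/eq_card => k; rewrite !inE andbC.
  by rewrite -topredE /= inE; case: (f k =P a) => [->|_]; rewrite ?andbT ?andbF // eq_sym.
apply: eq_card => k; rewrite !inE.
by case: (g (s k) =P a) => [/good ->|_]; rewrite ?eqxx ?andbT ?andbF.
Qed.
End Matching.

Section Coupling.
Context {R : realType}.

Definition coupling (A B : finType) (P : fdist R A) (Q : fdist R B)
    (p : A -> B -> R) : Prop :=
  [/\ forall a b, 0 <= p a b, forall a, \sum_b p a b = P a
    & forall b, \sum_a p a b = Q b].

(** The deficits [u] and [v] of the two marginals have the same total [t], so adding [u a * v b / t]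
    repairs both. If [t = 0] all deficits vanish, in agreement with division by zero giving zero. *)
Lemma extend_subcoupling (A B : finType) (P : fdist R A) (Q : fdist R B)
    (p : A -> B -> R) :
  (forall a b, 0 <= p a b) -> (forall a, \sum_b p a b <= P a) ->
  (forall b, \sum_a p a b <= Q b) ->
  exists2 q, coupling P Q q & forall a b, p a b <= q a b.
Proof.
move=> p0 pP pQ; pose u a := P a - \sum_b p a b; pose v b := Q b - \sum_a p a b.
have u0 a : 0 <= u a by rewrite subr_ge0.
have v0 b : 0 <= v b by rewrite subr_ge0.
pose t := \sum_a u a.
have tv : t = \sum_b v b by rewrite /t !sumrB !pmf_sum1 exchange_big.
have uE a : u a / t * t = u a.
  have [t0|t0] := eqVneq t 0; last by rewrite divfK.
  rewrite t0 mulr0; apply/esym/eqP; have /eqP := t0.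
  by rewrite psumr_eq0 // => /allP/(_ a (mem_index_enum _))/implyP; apply.
have vE b : t * (v b / t) = v b.
  have [t0|t0] := eqVneq t 0; last by rewrite mulrC divfK.
  rewrite t0 mul0r; apply/esym/eqP; have /eqP := t0; rewrite tv.
  by rewrite psumr_eq0 // => /allP/(_ b (mem_index_enum _))/implyP; apply.
have t0 : 0 <= t by apply: sumr_ge0.
have w0 a b : 0 <= u a * v b / t by rewrite !mulr_ge0 ?invr_ge0.
exists (fun a b => p a b + u a * v b / t); last by move=> a b; rewrite lerDl.
split=> [a b|a|b]; first by rewrite addr_ge0.
  rewrite big_split /=; under [X in _ + X]eq_bigr => b _ do rewrite mulrAC.
  by rewrite -mulr_sumr -tv uE addrC subrK.
rewrite big_split /=; under [X in _ + X]eq_bigr => a _ do rewrite -mulrA.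
by rewrite -mulr_suml vE addrC subrK.
Qed.

(* On each fibre [k] the subcoupling is the product measure scaled to have mass
   [min (P k) (Q k)]; a fibre of mass zero contributes nothing, by the convention
   x / 0 = 0. *)
Lemma exists_fibre_coupling (A B K : finType) (P : fdist R A) (Q : fdist R B)
    (c : A -> K) (d : B -> K) :
  exists2 q, coupling P Q q &
    \sum_a \sum_(b | c a != d b) q a b <= l1 (fdist_map P c) (fdist_map Q d).
Proof.
set Pc := fdist_map P c; set Qd := fdist_map Q d.
pose m k := Num.min (Pc k) (Qd k).
have m0 k : 0 <= m k by rewrite le_min !pmf_ge0.
pose p a b := if c a == d b then P a * Q b * (m (c a) / (Pc (c a) * Qd (c a))) else 0.
have p0 a b : 0 <= p a b.
  by rewrite /p; case: ifP => // _; rewrite mulr_ge0 ?divr_ge0 ?mulr_ge0 ?pmf_ge0.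
have sumb a : \sum_b p a b = P a * (m (c a) / Pc (c a)).
  transitivity (P a * Qd (c a) * (m (c a) / (Pc (c a) * Qd (c a)))).
    rewrite /p -big_mkcond -mulr_suml -mulr_sumr; congr (_ * _ * _).
    by apply: eq_bigl => b; rewrite eq_sym.
  rewrite -mulrA; congr (_ * _).
  have [Q0|Q0] := eqVneq (Qd (c a)) 0.
    by rewrite Q0 mul0r /m Q0 min_r ?mul0r ?pmf_ge0.
  by rewrite [Pc _ * _]mulrC invfM mulrCA mulVKf.
have suma b : \sum_a p a b = Q b * (m (d b) / Qd (d b)).
  transitivity (Pc (d b) * (Q b * (m (d b) / (Pc (d b) * Qd (d b))))).
    rewrite /p -big_mkcond mulr_suml; apply: eq_bigr => a /eqP ->.
    by rewrite mulrA.
  rewrite mulrCA; congr (_ * _).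
  have [P0|P0] := eqVneq (Pc (d b)) 0.
    by rewrite P0 mul0r /m P0 min_l ?mul0r ?pmf_ge0.
  by rewrite invfM mulrCA mulVKf.
have sub1 (T : finType) (S : fdist R T) (e : T -> K) (x : T) (y : R) :
    y <= fdist_map S e (e x) -> S x * (y / fdist_map S e (e x)) <= S x.
  move=> yS; rewrite ler_piMr ?pmf_ge0 //.
  have [->|S0] := eqVneq (fdist_map S e (e x)) 0; first by rewrite invr0 mulr0.
  by rewrite ler_pdivrMr ?mul1r // lt0r S0 pmf_ge0.
have [q qC pq] : exists2 q, coupling P Q q & forall a b, p a b <= q a b.
  apply: extend_subcoupling => // [a|b].
    by rewrite sumb; apply: sub1; rewrite ge_min lexx.
  by rewrite suma; apply: sub1; rewrite ge_min lexx orbT.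
exists q => //; have [q0 qP qQ] := qC.
(* As [q] dominates [p], its mass on matching fibres is at least [\sum_k m k]. What remains is at
   most the sum of the positive parts of [Pc k - Qd k]. *)
have le_diag : \sum_a \sum_b p a b <= \sum_a \sum_(b | c a == d b) q a b.
  apply: ler_sum => a _; rewrite [leRHS]big_mkcond; apply: ler_sum => b _ /=.
  by have := pq a b; rewrite {1 2}/p; case: ifP.
have tot : \sum_a \sum_(b | c a == d b) q a b + \sum_a \sum_(b | c a != d b) q a b = 1.
  rewrite -big_split -[RHS](pmf_sum1 P); apply: eq_bigr => a _ /=.
  by rewrite -qP [RHS](bigID (fun b => c a == d b)).
have pm : \sum_a \sum_b p a b = \sum_k m k.
  rewrite (partition_big c xpredT) //=; apply: eq_bigr => k _.
  rewrite (eq_bigr (fun a => P a * (m k / Pc k))) => [|a /eqP <-]; last exact: sumb.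
  transitivity (Pc k * (m k / Pc k)); first by rewrite [RHS]mulr_suml.
  rewrite mulrCA.
  have [P0|P0] := eqVneq (Pc k) 0; last by rewrite divff ?mulr1.
  by rewrite P0 mul0r mulr0 /m P0 min_l ?pmf_ge0.
have : 1 - \sum_k m k <= l1 Pc Qd.
  rewrite -(pmf_sum1 Pc) -sumrB; apply: ler_sum => k _; rewrite /m.
  by case: (leP (Pc k) (Qd k)) => _; rewrite ?subrr ?normr_ge0 ?ler_norm.
rewrite pm in le_diag; lra.
Qed.

(** * Hamming distance and Earth Mover Distance *)

Lemma dH_ge0 n (x y : cube n) : 0 <= dH R x y.
Proof. by rewrite divr_ge0. Qed.

Lemma dH_le1 n (x y : cube n) : dH R x y <= 1.
Proof.
case: n x y => [|n] x y; first by rewrite /dH invr0 mulr0.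
by rewrite ler_pdivrMr ?mul1r ?ltr0n // ler_nat -[leqRHS]card_ord max_card.
Qed.

Lemma dHC n (x y : cube n) : dH R x y = dH R y x.
Proof. by congr (_%:R / _); apply: eq_card => i; rewrite !inE eq_sym. Qed.

Lemma dH_triangle n (x y z : cube n) : dH R x z <= dH R x y + dH R y z.
Proof.
rewrite -mulrDl ler_wpM2r ?invr_ge0 // -natrD ler_nat.
rewrite -cardUI; apply: leq_trans (leq_addr _ _).
apply/subset_leq_card/fintype.subsetP => i; rewrite !inE.
by apply: contraNT; rewrite negb_or !negbK => /andP[/eqP -> /eqP ->].
Qed.

Lemma dH_perm n (s : {perm 'I_n}) (x y : cube n) :
  dH R (perm_word s x) (perm_word s y) = dH R x y.
Proof.
congr (_%:R / _); rewrite -(fintype.card_image (@perm_inj _ s)).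
apply: eq_card => i; rewrite -[i in LHS](permKV s) (fintype.mem_image (@perm_inj _ s)).
by rewrite !inE !ffunE permKV.
Qed.

(** Here [B] will be the set of test indices, where [h] may repeat values; summing the coupling over
    the fibres of [h] gives a transport plan. *)
Lemma dEM_le_coupling n (D1 D2 : fdist R (cube n)) (B : finType)
    (Q : fdist R B) (h : B -> cube n) (q : cube n -> B -> R) :
  coupling D1 Q q -> D2 =1 fdist_map Q h ->
  dEM D1 D2 <= \sum_x \sum_b q x b * dH R x (h b).
Proof.
move=> [q0 qP qQ] D2E; apply: ge_inf.
  exists 0 => _ [f [f01 _ _] ->]; apply: sumr_ge0 => x _; apply: sumr_ge0 => y _.
  by rewrite mulr_ge0 ?dH_ge0 //; case/andP: (f01 x y).
exists (fun x y => \sum_(b | h b == y) q x b); last first.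
  apply: eq_bigr => x _; rewrite (partition_big h xpredT) //=.
  by apply: eq_bigr => y _; rewrite mulr_suml; apply: eq_bigr => b /eqP ->.
have f0 x y : 0 <= \sum_(b | h b == y) q x b by apply: sumr_ge0.
have fP x : \sum_y \sum_(b | h b == y) q x b = D1 x.
  by rewrite -qP [RHS](partition_big h xpredT).
split=> // [x y|y].
  rewrite f0 /= -(pmf_sum1 D1); apply: (@le_trans _ _ (D1 x)).
    by rewrite -fP (bigD1 y) //= lerDl sumr_ge0.
  by rewrite [leRHS](bigD1 x) //= lerDl sumr_ge0 // => z _; exact: pmf_ge0.
rewrite D2E /= exchange_big /=; apply: eq_bigr => b _; exact: qQ.
Qed.

End Coupling.

(** * Empirical distributions and cells *)

Section Empirical.
Context {R : realType}.

Lemma l1C (K : finType) (p q : fdist R K) : l1 p q = l1 q p.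
Proof. by rewrite /l1; apply: eq_bigr => a _; rewrite distrC. Qed.

Lemma l1_triangle (K : finType) (p q u : fdist R K) : l1 p u <= l1 p q + l1 q u.
Proof. by rewrite /l1 -big_split; apply: ler_sum => a _; exact: ler_distD. Qed.

Lemma fdist_map_uniformE n (K : finType) (f : 'I_n.+1 -> K) a :
  fdist_map (fdist_uniform n) f a = #|[pred i | f i == a]|%:R / n.+1%:R :> R.
Proof. by rewrite /= sumr_const -[LHS]mulr_natl. Qed.

Lemma fdist_perm_map n (B : finType) (Q : fdist R B) (h : B -> cube n)
    (sigma : {perm 'I_n}) :
  fdist_perm (fdist_map Q h) sigma =1 fdist_map Q (perm_word sigma \o h).
Proof.
move=> w /=; apply: eq_bigl => b.
have Kl : cancel (perm_word sigma^-1%g) (@perm_word n sigma).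
  by move=> v; rewrite -[X in perm_word X _]invgK perm_wordK.
by apply/eqP/eqP => [->|<-]; rewrite ?Kl ?perm_wordK.
Qed.

Definition column N n (W : 'I_N -> cube n) (j : 'I_n) : {ffun 'I_N -> bool} :=
  [ffun k => W k j].

(** A row can differ only at a mismatched column, so a single permutation matching columns serves
    all rows at once. *)
Lemma exists_aligning_perm N n (V U : 'I_N -> cube n.+1) :
  exists sigma, forall k, dH R (V k) (perm_word sigma (U k)) <=
    l1 (fdist_map (fdist_uniform n) (column V)) (fdist_map (fdist_uniform n) (column U)).
Proof.
have [sigma le_bad] := exists_matching_perm (column V) (column U).
exists sigma => k.
apply: (@le_trans _ _ (#|[pred i | column V i != column U (sigma i)]|%:R / n.+1%:R)).
  rewrite ler_wpM2r ?invr_ge0 // ler_nat.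
  apply/subset_leq_card/fintype.subsetP => i; rewrite !inE ffunE.
  by apply: contraNneq => /ffunP/(_ k); rewrite !ffunE => ->.
rewrite -(ler_nat R) in le_bad.
apply: le_trans (ler_wpM2r _ le_bad) _; rewrite ?invr_ge0 // natr_sum mulr_suml.
apply: ler_sum => a _; rewrite !fdist_map_uniformE -mulrBl normrM [`|_^-1|]ger0_norm ?invr_ge0 //.
rewrite ler_wpM2r ?invr_ge0 //.
set b := #|[pred i | column V i == a]|; set c := #|[pred i | column U i == a]|.
have [cb|/ltnW bc] := leqP c b; first by rewrite natrB // ler_norm.
by move: bc; rewrite -subn_eq0 => /eqP ->; exact: normr_ge0.
Qed.

(** Choosing one centre makes disjoint cells out of overlapping balls; their number [s.+1] is
    independent of [n]. *)
Definition cell n s (rho : R) (V : 'I_s -> cube n) (x : cube n) : option 'I_s :=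
  [pick k | dH R x (V k) <= rho].

Definition far n s (rho : R) (V : 'I_s -> cube n) (x : cube n) : bool :=
  [forall k, rho < dH R x (V k)].

Lemma cell_None n s rho (V : 'I_s -> cube n) x : (cell rho V x == None) = far rho V x.
Proof.
rewrite /cell /far; case: pickP => [k kx|none]; apply/esym.
  by apply/negbTE/forallPn; exists k; rewrite -leNgt.
by rewrite eqxx; apply/forallP => k; rewrite ltNge none.
Qed.

(** Couple [D] with a uniform test index so that cells disagree with mass at most [eta]. In a common
    cell, [x] and [X l] are both within [rho] of one centre and [Z l] is [alpha] further; mismatched
    cells and far tests cost at most 1 each. *)
Lemma dEM_empirical_le n s m (D D2 : fdist R (cube n)) (V : 'I_s -> cube n)
    (X Z : 'I_m.+1 -> cube n) (rho alpha beta eta : R) :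
  D2 =1 fdist_map (fdist_uniform m) Z ->
  (forall l, dH R (X l) (Z l) <= alpha) -> 0 <= rho -> 0 <= alpha ->
  #|[pred l | far rho V (X l)]|%:R <= beta * m.+1%:R ->
  l1 (fdist_map (fdist_uniform m) (cell rho V \o X)) (fdist_map D (cell rho V)) <= eta ->
  dEM D D2 <= 2 * rho + alpha + beta + eta.
Proof.
move=> D2E XZ rho0 alpha0 le_beta le_eta.
have [q qC q_mis] := exists_fibre_coupling D (fdist_uniform m) (cell rho V) (cell rho V \o X).
apply: le_trans (dEM_le_coupling qC D2E) _; have [q0 qD qU] := qC.
pose F x l : R := 2 * rho + alpha + (far rho V (X l))%:R + (cell rho V x != cell rho V (X l))%:R.
apply: (@le_trans _ _ (\sum_x \sum_l q x l * F x l)).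
  apply: ler_sum => x _; apply: ler_sum => l _; rewrite ler_wpM2l //.
  have dle1 := dH_le1 (R := R) x (Z l); rewrite /F.
  have [cE|_] := eqVneq (cell rho V x) (cell rho V (X l)); last first.
    have : 0 <= (far rho V (X l))%:R :> R by [].
    rewrite /=; lra.
  rewrite -cell_None; case E : (cell rho V (X l)) => [k|] /=; last by lra.
  have near y : cell rho V y = Some k -> dH R y (V k) <= rho.
    by rewrite /cell; case: pickP => // k' ky [<-].
  have := near _ E; have := near _ (etrans cE E); have := XZ l.
  have := dH_triangle (R := R) x (V k) (X l); have := dH_triangle (R := R) x (X l) (Z l).
  rewrite (dHC (V k) (X l)); lra.
have -> : \sum_x \sum_l q x l * F x l =
    (2 * rho + alpha) + \sum_l m.+1%:R^-1 * (far rho V (X l))%:R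
    + \sum_x \sum_(l | cell rho V x != cell rho V (X l)) q x l.
  rewrite /F; under eq_bigr => x _ do
    (under eq_bigr => l _ do rewrite mulrDr mulrDr; rewrite 2!big_split /=).
  rewrite 2!big_split /=; congr (_ + _ + _).
  - under eq_bigr => x _ do rewrite -mulr_suml qD.
    by rewrite -mulr_suml pmf_sum1 mul1r.
  - rewrite exchange_big /=; apply: eq_bigr => l _.
    by rewrite -mulr_suml qU.
  - apply: eq_bigr => x _; rewrite [RHS]big_mkcond; apply: eq_bigr => l _.
    by case: ifP; rewrite (mulr1, mulr0).
have -> : \sum_l m.+1%:R^-1 * (far rho V (X l))%:R =
    #|[pred l | far rho V (X l)]|%:R / m.+1%:R :> R.
  by rewrite -mulr_sumr -natr_sum -big_mkcond sum1_card mulrC.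
rewrite -ler_pdivrMr ?ltr0Sn // in le_beta.
have le_mis : \sum_x \sum_(l | cell rho V x != cell rho V (X l)) q x l <= eta.
  by apply: le_trans q_mis _; rewrite l1C.
by rewrite lerD // lerD2l.
Qed.

Lemma far_mono n s (rho rho' : R) (V V' : 'I_s -> cube n) x x' :
  (forall k, dH R x (V k) + rho' <= dH R x' (V' k) + rho) ->
  far rho V x -> far rho' V' x'.
Proof.
move=> le /forallP farx; apply/forallP => k; have := farx k; have := le k; lra.
Qed.

End Empirical.

(** * Mass missed by the training samples *)

Section Hitting.
Context {R : realType}.

(** [(1 - p) ^+ s] is the least of the [s.+1] terms of a geometric sum, and [p] times that sum is
    [1 - (1 - p) ^+ s.+1]. *)
Lemma mul_pow_compl_le (p : R) s : 0 <= p <= 1 -> p * (1 - p) ^+ s <= s.+1%:R^-1.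
Proof.
move=> /andP[p0 p1]; rewrite -[leRHS]mul1r ler_pdivlMr ?ltr0Sn // -mulrA.
have := subrX1 (1 - p) s.+1; have := exprn_ge0 s.+1 (_ : 0 <= 1 - p).
rewrite subr_ge0 => /(_ p1) q0 qE.
have : (1 - p) ^+ s * s.+1%:R <= \sum_(i < s.+1) (1 - p) ^+ i.
  rewrite mulr_natr -[s.+1 in leLHS]card_ord -sumr_const; apply: ler_sum => i _.
  by apply: ler_wiXn2l; rewrite ?subr_ge0 // ?gerBl // -ltnS.
move=> /(ler_wpM2l p0); nra.
Qed.

Lemma expect_far_le n s (zeta delta : R) r (D : fdist R (cube n)) :
  clusterable zeta delta r D ->
  expect (fdist_iid D s) (fun V => expect D (fun x => (far delta V x)%:R))
  <= zeta + r%:R / s.+1%:R.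
Proof.
move=> [r' [r'r [C [Cpart C0 Cdiam]]]].
pose miss x := expect D (fun y => (delta < dH R x y)%R%:R).
have missE x : expect (fdist_iid D s) (fun V => (far delta V x)%:R) = miss x ^+ s.
  rewrite -[s in RHS]card_ord -prodr_const -expect_iid_prod.
  apply: eq_bigr => V _; congr (_ * _); rewrite /far.
  have [/forallP dV|/forallPn[k /negbTE dVk]] := boolP [forall k, (delta < dH R x (V k))%R].
    by rewrite big1 // => k _; rewrite dV.
  by rewrite (bigD1 k) //= dVk mul0r.
have -> : expect (fdist_iid D s) (fun V => expect D (fun x => (far delta V x)%:R))
    = \sum_x D x * miss x ^+ s.
  rewrite /expect; under eq_bigr => V _ do rewrite mulr_sumr.
  rewrite exchange_big; apply: eq_bigr => x _ /=.
  by rewrite -missE /expect mulr_sumr; apply: eq_bigr => V _; rewrite mulrCA.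
have miss0 x : 0 <= miss x.
  by apply: sumr_ge0 => y _; rewrite mulr_ge0 ?pmf_ge0.
have miss1 x : miss x <= 1.
  by rewrite -(expect_cst D 1); apply: le_expect => y; case: (_ < _).
have t0 x : 0 <= D x * miss x ^+ s by rewrite mulr_ge0 ?pmf_ge0 ?exprn_ge0.
pose p i := \sum_(x in C i) D x.
have p01 i : 0 <= p i <= 1.
  rewrite sumr_ge0 => [|x _]; last exact: pmf_ge0.
  rewrite -(pmf_sum1 D) /= [leRHS](bigID (mem (C i))) /= lerDl sumr_ge0 // => x _.
  exact: pmf_ge0.
(* A sample in the cluster of [x] is within [delta] of [x], so a miss must land outside the
   cluster. *)
have miss_le i x : i != ord0 -> x \in C i -> miss x <= 1 - p i.
  move=> i0 xi; rewrite -(pmf_sum1 D) [X in _ <= X - _](bigID (mem (C i))) /=.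
  rewrite addrAC subrr add0r /miss /expect (bigID (mem (C i))) /= big1 ?add0r.
    apply: ler_sum => y _; rewrite ler_piMr ?pmf_ge0 //; by case: (_ < _).
  by move=> y yi; rewrite ltNge (Cdiam i) // mulr0.
apply: (@le_trans _ _ (\sum_i \sum_(x in C i) D x * miss x ^+ s)).
  rewrite (exchange_big_dep xpredT) //=; apply: ler_sum => x _.
  have [i [xi _]] := Cpart x.
  by rewrite (bigD1 i) //= lerDl sumr_ge0.
(* The exceptional block contributes at most its own mass, each other block at most [s.+1%:R^-1]. *)
rewrite (bigD1 ord0) //= lerD //.
  apply: le_trans C0; apply: ler_sum => x _.
  by rewrite ler_piMr ?pmf_ge0 // exprn_ile1.
apply: (@le_trans _ _ (\sum_(i < r'.+1 | i != ord0) s.+1%:R^-1)).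
  apply: ler_sum => i i0; apply: le_trans (mul_pow_compl_le s (p01 i)).
  rewrite /p mulr_suml; apply: ler_sum => x xi; rewrite ler_wpM2l ?pmf_ge0 //.
  by rewrite lerXn2r ?nnegrE ?miss_le //; case/andP: (p01 i) => *; rewrite subr_ge0.
rewrite sumr_const -[leLHS]mulr_natl ler_wpM2r ?invr_ge0 // ler_nat.
by rewrite cardC1 card_ord.
Qed.
End Hitting.

(** * The algorithm *)

Section Algorithm.
Context {R : realType}.
Variables (n s m t : nat) (zeta delta : R).
Let N := (s + m.+1)%N.

Definition train (W : 'I_N -> cube n.+1) : 'I_s -> cube n.+1 := W \o @lshift s m.+1.
Definition test (W : 'I_N -> cube n.+1) : 'I_m.+1 -> cube n.+1 := W \o @rshift s m.+1.

Definition far_tests (rho : R) (W : 'I_N -> cube n.+1) : R :=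
  #|[pred l | far rho (train W) (test W l)]|%:R.

(** The tolerance [delta / 2] is spent twice: from the observed columns to [U], and from them to the
    true samples. *)
Definition consistent (obs : 'I_t.+1 -> {ffun 'I_N -> bool})
    (U : {ffun 'I_N -> cube n.+1}) : bool :=
  l1 (fdist_map (fdist_uniform t) obs) (fdist_map (fdist_uniform n) (column U))
  <= delta / 2.

(** The factor 10 leaves room for Markov's inequality, since the expected far fraction will be at
    most [11 * zeta / 10] in the clusterable case. *)
Definition reconstruct (obs : 'I_t.+1 -> {ffun 'I_N -> bool}) :
    option (fdist R (cube n.+1)) :=
  if [pick U | consistent obs U] is Some U then
    if far_tests (3 * delta) U <= 10 * zeta * m.+1%:R
    then Some (fdist_map (fdist_uniform m) (test U)) else None
  else None.

(** Reading the same coordinates in every sample makes each [c j] reveal a whole column. The default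
    [false] never occurs, because [c j] lies in the query set. *)
Definition cluster_alg : nonadaptive_alg R n.+1 :=
  @NonadaptiveAlg R n.+1 {ffun 'I_t.+1 -> 'I_n.+1}
    (fdist_iid (fdist_uniform n) t.+1) N
    (fun c _ => [set c j | j : 'I_t.+1])
    (fun c a => reconstruct (fun j => [ffun k => odflt false (a k (c j))])).

Lemma nqueries_cluster_alg (c : coins cluster_alg) :
  (nqueries c <= N * t.+1)%N.
Proof.
rewrite /nqueries /= -[N in leqRHS]card_ord -sum_nat_const; apply: leq_sum => k _.
by apply: leq_trans (leq_imset_card _ _) _; rewrite card_ord.
Qed.

Lemma run_cluster_alg (c : coins cluster_alg) (V : {ffun 'I_N -> cube n.+1}) :
  run c V = reconstruct (column V \o c).
Proof.
rewrite /run /=; congr reconstruct; apply/funext => j; apply/ffunP => k.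
by rewrite !ffunE /read imset_f.
Qed.

Variable D : fdist R (cube n.+1).
Hypothesis delta_gt0 : 0 < delta.

Definition coords_bad (c : 'I_t.+1 -> 'I_n.+1) (V : 'I_N -> cube n.+1) : Prop :=
  delta / 2 < l1 (fdist_map (fdist_uniform t) (column V \o c))
                 (fdist_map (fdist_uniform n) (column V)).

Definition cells_bad (V : 'I_N -> cube n.+1) : Prop :=
  delta < l1 (fdist_map (fdist_uniform m) (cell (5 * delta) (train V) \o test V))
             (fdist_map D (cell (5 * delta) (train V))).

Lemma consistent_aligned c (V U : {ffun 'I_N -> cube n.+1}) :
  ~ coords_bad c V -> consistent (column V \o c) U ->
  exists sigma, forall k, dH R (V k) (perm_word sigma (U k)) <= delta.
Proof.
move=> /negP; rewrite -leNgt /consistent => le1 le2.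
have [sigma le] := @exists_aligning_perm R _ _ V U.
exists sigma => k; apply: le_trans (le k) _.
apply: le_trans (l1_triangle _ (fdist_map (fdist_uniform t) (column V \o c)) _) _.
by rewrite l1C [leRHS]splitr lerD.
Qed.

Lemma dH_aligned sigma (V U : {ffun 'I_N -> cube n.+1}) j k :
  (forall k, dH R (V k) (perm_word sigma (U k)) <= delta) ->
  dH R (V j) (V k) <= dH R (U j) (U k) + 2 * delta /\
  dH R (U j) (U k) <= dH R (V j) (V k) + 2 * delta.
Proof.
move=> VU; rewrite -[dH R (U j) (U k)](dH_perm sigma).
have := VU j; have := VU k.
set u := perm_word sigma (U j); set v := perm_word sigma (U k) => kv ju.
have := dH_triangle (R := R) (V j) u (V k); have := dH_triangle (R := R) u v (V k).
have := dH_triangle (R := R) u (V j) v; have := dH_triangle (R := R) (V j) (V k) v.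
rewrite (dHC v (V k)) (dHC u (V j)); lra.
Qed.

(* [5 delta] allows for an error of [2 delta] over the radius [3 delta] tested on
   [U]; likewise [3 delta] in [run_fail] over the cluster diameter [delta]. *)
Lemma run_close (c : coins cluster_alg) (V : {ffun 'I_N -> cube n.+1}) D' :
  ~ coords_bad c V -> ~ cells_bad V -> 0 < zeta -> run c V = Some D' ->
  exists sigma, dEM D (fdist_perm D' sigma) <= 17 * (delta + zeta).
Proof.
move=> good1 /negP good2 zeta0; rewrite run_cluster_alg /reconstruct.
case: pickP => // U UV; case: ifP => // few [<-].
have [sigma VU] := consistent_aligned good1 UV; exists sigma.
rewrite -leNgt in good2.
apply: le_trans (dEM_empirical_le (fdist_perm_map _ _ _) (fun l => VU (rshift s l)) _ _ _ good2) _.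
- by rewrite mulr_ge0 // ltW.
- exact: ltW.
- apply: le_trans few; rewrite ler_nat.
  apply/subset_leq_card/fintype.subsetP => l; rewrite !inE.
  apply: far_mono => k; have [] := dH_aligned (rshift s l) (lshift m.+1 k) VU.
  by rewrite /train /test /=; lra.
(* The total is [12 * delta + 10 * zeta]: [10 * delta] for the cells, [delta] for the alignment,
   [10 * zeta] for far tests and [delta] for the cell masses. *)
move: (delta_gt0) zeta0; lra.
Qed.

Lemma run_fail (c : coins cluster_alg) (V : {ffun 'I_N -> cube n.+1}) :
  run c V = None -> coords_bad c V \/ 10 * zeta * m.+1%:R < far_tests delta V.
Proof.
rewrite run_cluster_alg /reconstruct; case: pickP => [U UV|none _].
  have [|good1] := pselect (coords_bad c V); first by left.
  case: ifP => // /negbT; rewrite -ltNge => many _; right.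
  apply: lt_le_trans many _; rewrite ler_nat.
  have [sigma VU] := consistent_aligned good1 UV.
  apply/subset_leq_card/fintype.subsetP => l; rewrite !inE.
  apply: far_mono => k; have [] := dH_aligned (rshift s l) (lshift m.+1 k) VU.
  by rewrite /train /test /=; lra.
(* The true matrix [V] is itself a candidate, so if none is consistent the coordinates are bad. *)
by left; rewrite /coords_bad ltNge; apply/negP => le; have := none V; rewrite /consistent le.
Qed.

Let P := fdist_prod (fdist_iid (fdist_uniform n) t.+1) (fdist_iid D N).

(** For fixed samples, [c] draws [t.+1] independent columns, and a column takes at most [2 ^ N]
    values whatever [n] is. *)
Lemma prob_coords_bad :
  prob P (fun x => coords_bad x.1 x.2) <=
  #|{ffun 'I_N -> bool}|%:R / (t.+1%:R * (delta / 2) ^+ 2).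
Proof.
rewrite prob_fdist_prod -[leRHS](expect_cst (fdist_iid D N)).
apply: le_expect => V; rewrite /coords_bad /=.
by apply: (empirical_l1 (fdist_uniform n) (column V) t); rewrite divr_gt0.
Qed.

Lemma prob_samples (E : {ffun 'I_N -> cube n.+1} -> Prop) :
  prob P (fun x => E x.2) = prob (fdist_iid D N) E.
Proof.
rewrite prob_fdist_prod [RHS]prob_expect; apply: eq_bigr => V _; congr (_ * _).
by rewrite prob_expect /= expect_cst.
Qed.

Lemma train_cat (y : {ffun 'I_s -> cube n.+1}) (z : {ffun 'I_m.+1 -> cube n.+1}) :
  train (ffun_cat y z) = y.
Proof. by apply/funext => k; rewrite /train /= ffun_catl. Qed.

Lemma test_cat (y : {ffun 'I_s -> cube n.+1}) (z : {ffun 'I_m.+1 -> cube n.+1}) :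
  test (ffun_cat y z) = z.
Proof. by apply/funext => k; rewrite /test /= ffun_catr. Qed.

(** Fixing the training samples fixes the cells, and the test samples remain independent of them;
    this is why the two groups are kept apart. *)
Lemma prob_cells_bad :
  prob P (fun x => cells_bad x.2) <= #|{: option 'I_s}|%:R / (m.+1%:R * delta ^+ 2).
Proof.
rewrite (prob_samples cells_bad) prob_expect expect_iid_cat.
rewrite -[leRHS](expect_cst (fdist_iid D s)).
apply: le_expect => y; rewrite -prob_expect.
apply: le_trans (empirical_l1 D (cell (5 * delta) y) m delta_gt0).
by apply: prob_mono => z; rewrite /cells_bad train_cat test_cat.
Qed.

(** Given the training samples, each test sample is far with probability the far mass of [D];
    [expect_far_le] bounds its average and Markov's inequality concludes. *)
Lemma prob_far_tests r :
  0 < zeta -> clusterable zeta delta r D ->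
  prob P (fun x => 10 * zeta * m.+1%:R < far_tests delta x.2) <=
  (zeta + r%:R / s.+1%:R) / (10 * zeta).
Proof.
move=> zeta0 Dcl; rewrite (prob_samples (fun V => 10 * zeta * m.+1%:R < far_tests delta V)).
apply: le_trans (markov _ _ _) _ => [|V|]; rewrite ?ler0n ?mulr_gt0 //.
rewrite invfM mulrA [_ / (10 * zeta)]mulrC -mulrA [leRHS]mulrC ler_wpM2l //.
  by rewrite invr_ge0 mulr_ge0 // ltW.
rewrite ler_pdivrMr ?ltr0Sn //; apply: le_trans (ler_wpM2r _ (expect_far_le s Dcl)) => //.
rewrite expect_iid_cat [leRHS]mulrC -expectZ; apply: le_expect => y.
have -> : expect (fdist_iid D m.+1) (fun z => far_tests delta (ffun_cat y z)) =
    expect (fdist_iid D m.+1) (fun z => \sum_l (far delta y (z l))%:R).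
  apply: eq_bigr => z _; congr (_ * _); rewrite /far_tests train_cat test_cat.
  by rewrite -natr_sum -big_mkcond sum1_card.
rewrite expect_sum (eq_bigr (fun=> expect D (fun x => (far delta y x)%:R))) => [|l _].
  by rewrite sumr_const card_ord mulr_natl.
by rewrite (expect_iid_coord D (fun x => (far delta y x)%:R)).
Qed.
End Algorithm.

(** * Choice of the sample sizes and conclusion *)

Lemma exists_sample_size (R : realType) (k : nat) (e : R) :
  0 < e -> exists m : nat, k%:R / (m.+1%:R * e) <= 1 / 10.
Proof.
move=> e0; have u0 : 0 <= 10 * k%:R / e by rewrite divr_ge0 ?mulr_ge0 // ltW.
have := archi_boundP u0; set m := Num.bound _ => lem; exists m.
rewrite ler_pdivrMr ?mulr_gt0 ?ltr0Sn //.
have : 10 * k%:R <= m.+1%:R * e.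
  by rewrite -ler_pdivrMr // ltW // (lt_le_trans lem) // ler_nat.
lra.
Qed.

Lemma dEM_cube0 (R : realType) (D1 D2 : fdist R (cube 0)) : dEM D1 D2 <= 0.
Proof.
have [q qC _] := exists_fibre_coupling D1 D2 (fun=> tt) (fun=> tt).
have D2E : D2 =1 fdist_map D2 id by move=> x; rewrite /= big_pred1_eq.
apply: le_trans (dEM_le_coupling qC D2E) _.
rewrite big1 // => x _; rewrite big1 // => y _.
by rewrite /dH invr0 !mulr0.
Qed.

Lemma exists_cluster_alg (R : realType) (zeta delta : R) (r : nat) :
  0 < zeta < 1 -> 0 < delta < 1 ->
  exists q : nat, forall n : nat, exists alg : nonadaptive_alg R n,
    (forall c : coins alg, (nqueries c <= q)%N) /\
    (forall D : fdist R (cube n),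
       clusterable zeta delta r D ->
       2 / 3 <= prob_run alg D (fun o =>
         exists2 D', o = Some D' &
           exists sigma : {perm 'I_n},
             dEM D (fdist_perm D' sigma) <= 17 * (delta + zeta))) /\
    (forall D : fdist R (cube n),
       prob_run alg D (fun o =>
         exists2 D', o = Some D' &
           forall sigma : {perm 'I_n},
             dEM D (fdist_perm D' sigma) > 17 * (delta + zeta))
       <= 1 / 3).
Proof.
move=> /andP[zeta0 _] /andP[delta0 _].
(* The order matters: the number of cells depends on [s], and the number of possible columns on both
   [s] and [m]. *)
have [s sP] := exists_sample_size r zeta0.
have [m mP] := exists_sample_size #|{: option 'I_s}| (exprn_gt0 2 delta0).
have [t tP] := exists_sample_size #|{ffun 'I_(s + m.+1) -> bool}|
  (exprn_gt0 2 (divr_gt0 delta0 (ltr0Sn R 1))).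
exists ((s + m.+1) * t.+1)%N => -[|n].
  (* For [n = 0] there is no coordinate to draw, and the only distribution can be output at once. *)
  pose D0 : fdist R (cube 0) := fdist_map (fdist_uniform 0) (fun=> [ffun=> false]).
  exists (@NonadaptiveAlg R 0 'I_1 (fdist_uniform 0) 0
    (fun _ _ => finset.set0) (fun _ _ => Some D0)).
  have close D sigma : dEM D (fdist_perm D0 sigma) <= 17 * (delta + zeta).
    by apply: le_trans (dEM_cube0 _ _) _; lra.
  split; [|split] => [c|D _|D].
  - by rewrite /nqueries big_ord0.
  - rewrite /prob_run prob_sure; first by lra.
    by move=> x; exists D0 => //; exists 1%g; exact: close.
  - rewrite /prob_run prob_compl prob_sure; first by lra.
    by move=> x [D' [<-] /(_ 1%g)]; rewrite ltNge close.
exists (cluster_alg n s m t zeta delta); split; first exact: nqueries_cluster_alg.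
split=> [D Dcl|D];
  pose P := fdist_prod (fdist_iid (fdist_uniform n) t.+1) (fdist_iid D (s + m.+1)).
  set good := (fun o => exists2 D', o = Some D' & _).
  have bad : prob_run (cluster_alg n s m t zeta delta) D (fun o => ~ good o) <=
    prob P (fun x => coords_bad delta x.1 x.2 \/ cells_bad delta D x.2 \/
      10 * zeta * m.+1%:R < far_tests delta x.2).
    apply: prob_mono => x; apply: contra_notP => /not_orP[good1 /not_orP[good2 good3]].
    case E : (run x.1 x.2) => [D'|]; first by exists D' => //; exact: run_close E.
    by case: (run_fail E).
  have or1 := prob_or P (fun x => coords_bad delta x.1 x.2) (fun x => cells_bad delta D x.2 \/
      10 * zeta * m.+1%:R < far_tests delta x.2).
  have or2 := prob_or P (fun x => cells_bad delta D x.2) (fun x =>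
      10 * zeta * m.+1%:R < far_tests delta x.2).
  have le1 : prob P (fun x => coords_bad delta x.1 x.2) <= 1 / 10.
    exact: le_trans (prob_coords_bad s m t D delta0) tP.
  have le2 : prob P (fun x => cells_bad delta D x.2) <= 1 / 10.
    exact: le_trans (prob_cells_bad s m t D delta0) mP.
  (* The other two events leave [1 / 3 - 2 / 10 = 2 / 15]; the choice of [s] in fact yields
     [11 / 100]. *)
  have le3 : prob P (fun x => 10 * zeta * m.+1%:R < far_tests delta x.2) <= 2 / 15.
    apply: le_trans (prob_far_tests s m t zeta0 Dcl) _.
    have rs : r%:R / s.+1%:R <= zeta / 10.
      have : r%:R / s.+1%:R / zeta <= 1 / 10 by rewrite -mulrA -invfM.
      by rewrite ler_pdivrMr // mul1r [leRHS]mulrC.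
    rewrite ler_pdivrMr ?mulr_gt0 //; move: (r%:R / _) rs => w; lra.
  rewrite /prob_run prob_compl; rewrite /prob_run in bad; lra.
(* Too many far tests only lead to failure, so a wrong output requires one of the first two
   events. *)
have bad : prob_run (cluster_alg n s m t zeta delta) D (fun o => exists2 D', o = Some D' &
      forall sigma, dEM D (fdist_perm D' sigma) > 17 * (delta + zeta)) <=
    prob P (fun x => coords_bad delta x.1 x.2 \/ cells_bad delta D x.2).
  apply: prob_mono => x [D' runE lt]; apply: contrapT => /not_orP[good1 good2].
  have [sigma le] := run_close delta0 good1 good2 zeta0 runE.
  by have := lt sigma; rewrite ltNge le.
have or1 := prob_or P (fun x => coords_bad delta x.1 x.2) (fun x => cells_bad delta D x.2).
have le1 : prob P (fun x => coords_bad delta x.1 x.2) <= 1 / 10.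
  exact: le_trans (prob_coords_bad s m t D delta0) tP.
have le2 : prob P (fun x => cells_bad delta D x.2) <= 1 / 10.
  exact: le_trans (prob_cells_bad s m t D delta0) mP.
lra.
Qed.

Theorem theorem4p2 (R : realType) :
  exists (q : R -> R -> nat -> nat)
         (A : forall n : nat, R -> R -> nat -> nonadaptive_alg R n),
  forall (n : nat) (zeta delta : R) (r : nat),
    0 < zeta < 1 -> 0 < delta < 1 ->
    let eps := 17 * (delta + zeta) in
    eps < 1 ->
    let alg := A n zeta delta r in
    (forall c : coins alg, (nqueries c <= q zeta delta r)%N) /\
    (forall D : fdist R (cube n),
       clusterable zeta delta r D ->
       2 / 3 <= prob_run alg D (fun o =>
         exists2 D', o = Some D' &
           exists sigma : {perm 'I_n}, dEM D (fdist_perm D' sigma) <= eps)) /\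
    (forall D : fdist R (cube n),
       prob_run alg D (fun o =>
         exists2 D', o = Some D' &
           forall sigma : {perm 'I_n}, dEM D (fdist_perm D' sigma) > eps)
       <= 1 / 3).
Proof.
(* A filler for parameters outside the unit interval, where nothing is claimed. *)
have trivial_alg n : nonadaptive_alg R n.
  exact: (@NonadaptiveAlg R n 'I_1 (fdist_uniform 0) 0 (fun _ _ => finset.set0) (fun _ _ => None)).
(* Choosing per parameter triple, before [n], yields a query bound that is a function of the
   parameters alone. *)
have /choice[F FP] : forall p : R * R * nat,
    exists qA : nat * (forall n, nonadaptive_alg R n),
    0 < p.1.1 < 1 -> 0 < p.1.2 < 1 -> forall n,
    [/\ (forall c : coins (qA.2 n), (nqueries c <= qA.1)%N),
     (forall D : fdist R (cube n), clusterable p.1.1 p.1.2 p.2 D ->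
       2 / 3 <= prob_run (qA.2 n) D (fun o => exists2 D', o = Some D' &
         exists sigma, dEM D (fdist_perm D' sigma) <= 17 * (p.1.2 + p.1.1)))
     & (forall D : fdist R (cube n),
       prob_run (qA.2 n) D (fun o => exists2 D', o = Some D' &
         forall sigma, dEM D (fdist_perm D' sigma) > 17 * (p.1.2 + p.1.1)) <= 1 / 3)].
  move=> [[zeta delta] r] /=.
  have [zd|nzd] := pselect (0 < zeta < 1 /\ 0 < delta < 1); last first.
    by exists (0%N, trivial_alg) => *; case: nzd.
  have [q qP] := exists_cluster_alg r zd.1 zd.2.
  exists (q, fun n => projT1 (cid (qP n))) => _ _ n /=.
  by case: (projT2 (cid (qP n))) => ? [].
exists (fun zeta delta r => (F (zeta, delta, r)).1).
exists (fun n zeta delta r => (F (zeta, delta, r)).2 n).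
move=> n zeta delta r zeta01 delta01 eps _ alg.
by have [] := FP (zeta, delta, r) zeta01 delta01 n.
Qed.
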